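(* There is no non-trivial decidable group property for groups given by co-recursive presentations. That is, if $P$ is an isomorphism-invariant property of groups for which there is an algorithm that, given any $\nu_{co-RP}$-name of a marked group $(G,S)$, halts and decides whether $G$ satisfies $P$, then either every co-recursively presented group satisfies $P$ or no co-recursively presented group satisfies $P$.
   Context: A $k$-marked group is a pair $(G,S)$ with $G$ a group and $S=(s_1,\dots,s_k)\in G^k$ a tuple generating $G$. Marked groups are considered up to isomorphism of marked groups (group isomorphism matching the generating tuples in order). Let $\langle n,m\rangle$ be a computable bijection $\mathbb{N}^2\to\mathbb{N}$ with computable inverse, $\mathcal{A}_n=\{x_1,\dots,x_n\}$, $\theta_n:\mathbb{N}\to(\mathcal{A}_n\cup\mathcal{A}_n^{-1})^*$ a natural computable bijection uniformly in $n\ge1$, $\varphi_0,\varphi_1,\dots$ a standard enumeration of the partial computable functions, $W_i=\mathrm{dom}(\varphi_i)$. The co-word problem of an $n$-marked group is the set of all words in $(\mathcal{A}_n\cup\mathcal{A}_n^{-1})^*$ defining non-identity elements. The numbering of co-recursive presentations is $\nu_{co-RP}(\langle n,i\rangle)=\langle\mathcal{A}_n\mid(\theta_n(W_i))^c\rangle$ (marked by $(x_1,\dots,x_n)$, complement in $(\mathcal{A}_n\cup\mathcal{A}_n^{-1})^*$), with domain the set of $\langle n,i\rangle$ such that $\theta_n(W_i)$ is the co-word problem of some $n$-marked group. A $\nu_{co-RP}$-name of a marked group is an integer mapped to it by $\nu_{co-RP}$; a marked group is co-recursively presented if it has such a name, and a group is co-recursively presented if it has a marking that is. *)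

(* Defs.v *)
From HB Require Import structures.
From Stdlib Require Cantor.
From mathcomp Require Import all_boot.
From mathcomp Require Import boolp.

Set Implicit Arguments.
Unset Strict Implicit.
Unset Printing Implicit Defensive.

Local Open Scope nat_scope.

Definition cpair (x y : nat) : nat := Cantor.to_nat (x, y).

(* Programs for Kleene's partial recursive functions, in unary form: a function
   of several arguments takes them packed with the Cantor pairing. *)
Inductive code : Type :=
| CZero
| CSucc
| CFst
| CSnd
| CPair of code & code
| CComp of code & code
| CPrec of code & code
| CMu of code.

(* [evals c x y]: the program c, run on input x, halts with output y. *)
Fixpoint evals (c : code) : nat -> nat -> Prop :=
  match c with
  | CZero => fun _ y => y = 0
  | CSucc => fun x y => y = x.+1
  | CFst => fun x y => y = (Cantor.of_nat x).1
  | CSnd => fun x y => y = (Cantor.of_nat x).2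
  | CPair c d => fun x y =>
      exists a b, [/\ evals c x a, evals d x b & y = cpair a b]
  | CComp c d => fun x y => exists2 a, evals d x a & evals c a y
  | CPrec c d => fun x y =>
      let a := (Cantor.of_nat x).1 in
      (fix prec (n : nat) : nat -> Prop :=
         if n is m.+1
         then fun z => exists2 v, prec m v & evals d (cpair a (cpair m v)) z
         else fun z => evals c a z) (Cantor.of_nat x).2 y
  | CMu c => fun x y =>
      evals c (cpair x y) 0 /\
      forall z, z < y -> exists v, evals c (cpair x z) v.+1
  end.

Definition computable (f : nat -> nat) : Prop :=
  exists c, forall x, evals c x (f x).

Definition computable2 (f : nat -> nat -> nat) : Prop :=
  exists c, forall x y, evals c (cpair x y) (f x y).

Fixpoint godel (c : code) : nat :=
  match c with
  | CZero => 0
  | CSucc => 1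
  | CFst => 2
  | CSnd => 3
  | CPair c d => 4 + 4 * cpair (godel c) (godel d)
  | CComp c d => 5 + 4 * cpair (godel c) (godel d)
  | CPrec c d => 6 + 4 * cpair (godel c) (godel d)
  | CMu c => 7 + 4 * godel c
  end.

(* An enumeration of partial functions is given by its graph:
   [phi i x y] means that phi_i(x) is defined and equal to y. *)
Definition godel_enum (i x y : nat) : Prop :=
  exists2 c, godel c = i & evals c x y.

(* The standard enumerations are the acceptable ones: those which can be
   effectively translated to and from the enumeration by Goedel numbers of
   programs (Rogers). *)
Definition standard_enum (phi : nat -> nat -> nat -> Prop) : Prop :=
  exists f g, [/\ computable f, computable g,
    forall i x y, phi i x y <-> godel_enum (f i) x y &
    forall i x y, godel_enum i x y <-> phi (g i) x y].

Definition W (phi : nat -> nat -> nat -> Prop) (i x : nat) : Prop :=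
  exists y, phi i x y.

Definition computable_pairing (pr : nat -> nat -> nat) : Prop :=
  computable2 pr /\
  exists p1 p2, [/\ computable p1, computable p2,
    forall n m, p1 (pr n m) = n /\ p2 (pr n m) = m &
    forall k, pr (p1 k) (p2 k) = k].

(* (i, false) is the letter x_i and (i, true) its formal inverse. *)
Definition word (n : nat) : Type := seq ('I_n * bool).

Definition linv n (a : 'I_n * bool) : 'I_n * bool := (a.1, ~~ a.2).
Definition winv n (w : word n) : word n := rev [seq linv a | a <- w].

(* Reference coding of words by integers, uniform in n; it serves only to say
   when a numbering of words is computable. *)
Definition wcode n (w : word n) : nat :=
  foldr (fun (a : 'I_n * bool) r => (cpair (a.1.*2 + a.2) r).+1) 0 w.

(* Nothing is required for n = 0, where there is only one word. *)
Definition computable_words (theta : forall n, nat -> word n) : Prop :=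
  (forall n, 0 < n -> bijective (theta n)) /\
  exists c, forall n m, 0 < n -> evals c (cpair n m) (wcode (theta n m)).

Section WordValue.
Variables (G : groupType) (k : nat) (s : k.-tuple G).

Definition letter_val (a : 'I_k * bool) : G :=
  if a.2 then ((tnth s a.1)^-1)%g else tnth s a.1.

Definition word_val (w : word k) : G := foldr (fun a g => (letter_val a * g)%g) 1%g w.

Definition generates : Prop := forall g : G, exists w, word_val w = g.

End WordValue.

Record marked_group (k : nat) := MarkedGroup {
  mg_group :> groupType;
  mg_gens : k.-tuple mg_group;
  mg_gensP : generates mg_gens
}.

Definition isomorphic (G H : groupType) : Prop :=
  exists f : {multiplicative G -> H}, bijective f.

Definition marked_iso k (M N : marked_group k) : Prop :=
  exists f : {multiplicative M -> N},
    bijective f /\ forall i, f (tnth (mg_gens M) i) = tnth (mg_gens N) i.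

Definition coWP k (M : marked_group k) (w : word k) : Prop :=
  word_val (mg_gens M) w <> 1%g.

(* The group <x_1, ..., x_n | R> is the quotient of the monoid of words by this
   congruence; inverses come from formal inversion, see pres_mulwV. *)
Inductive pres_eq n (R : word n -> Prop) : word n -> word n -> Prop :=
| pres_refl u : pres_eq R u u
| pres_sym u v : pres_eq R u v -> pres_eq R v u
| pres_trans u v w : pres_eq R u v -> pres_eq R v w -> pres_eq R u w
| pres_cat u u' v v' :
    pres_eq R u u' -> pres_eq R v v' -> pres_eq R (u ++ v) (u' ++ v')
| pres_cancel a : pres_eq R [:: a; linv a] [::]
| pres_rel r : R r -> pres_eq R r [::].

Section Presentation.
Variables (n : nat) (R : word n -> Prop).

Local Notation word := (seq ('I_n * bool)).

Definition pres_rel_bool : rel word := fun u v => `[< pres_eq R u v >].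

Lemma pres_rel_is_equiv : equiv_class_of pres_rel_bool.
Proof.
split.
- by move=> u; apply/asboolP; apply: pres_refl.
- by move=> u v; apply/asboolP/asboolP; apply: pres_sym.
- by move=> v u w /asboolP uv /asboolP vw; apply/asboolP; apply: pres_trans vw.
Qed.

Canonical pres_rel_equiv := EquivRelPack pres_rel_is_equiv.

Definition pres : Type := {eq_quot pres_rel_bool}%qT.

HB.instance Definition _ := Choice.on pres.
HB.instance Definition _ := EqQuotient.on pres.

Local Open Scope quotient_scope.

Definition pres_class (w : word) : pres := \pi_pres w.

Lemma pres_classE u v : pres_class u = pres_class v <-> pres_eq R u v.
Proof.
split; first by move/eqmodP/asboolP.
by move=> uv; apply/eqmodP/asboolP.
Qed.

Lemma pres_reprP u : pres_eq R (repr (pres_class u)) u.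
Proof. by apply/pres_classE; rewrite /pres_class reprK. Qed.

Lemma pres_classP (x : pres) : exists u, x = pres_class u.
Proof. by exists (repr x); rewrite /pres_class reprK. Qed.

Lemma linvK : involutive (@linv n).
Proof. by case=> i b; rewrite /linv /= negbK. Qed.

Lemma winv_cons a (u : word) : winv (a :: u) = winv u ++ [:: linv a].
Proof. by rewrite /winv /= rev_cons cats1. Qed.

Lemma pres_mulwV (u : word) : pres_eq R (u ++ winv u) [::].
Proof.
elim: u => [|a u IHu]; first exact: pres_refl.
rewrite winv_cons -[a :: u]cat1s -catA [u ++ _]catA.
apply: (pres_trans (v := [:: a] ++ ([::] ++ [:: linv a]))).
  by do 2![apply: pres_cat => //; try exact: pres_refl].
exact: pres_cancel.
Qed.

Lemma winvK : involutive (@winv n).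
Proof.
move=> u; rewrite /winv map_rev revK -map_comp -[RHS]map_id.
by apply: eq_map => a /=; rewrite linvK.
Qed.

Lemma pres_mulVw (u : word) : pres_eq R (winv u ++ u) [::].
Proof. by rewrite -{2}[u]winvK; apply: pres_mulwV. Qed.

Lemma pres_inv (u v : word) : pres_eq R u v -> pres_eq R (winv u) (winv v).
Proof.
move=> uv; apply: (pres_trans (v := winv u ++ (v ++ winv v))).
  rewrite -[X in pres_eq _ X _]cats0; apply: pres_cat; first exact: pres_refl.
  exact/pres_sym/pres_mulwV.
rewrite catA -[X in pres_eq _ _ X]cat0s.
apply: pres_cat; last exact: pres_refl.
apply: pres_trans (pres_mulVw u); apply: pres_cat; first exact: pres_refl.
exact: pres_sym.
Qed.

Definition pres_mul (x y : pres) : pres := pres_class (repr x ++ repr y).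
Definition pres_invg (x : pres) : pres := pres_class (winv (repr x)).
Definition pres_one : pres := pres_class [::].

Lemma pres_mulE u v :
  pres_mul (pres_class u) (pres_class v) = pres_class (u ++ v).
Proof. by apply/pres_classE; apply: pres_cat; apply: pres_reprP. Qed.

Lemma pres_invE u : pres_invg (pres_class u) = pres_class (winv u).
Proof. by apply/pres_classE/pres_inv/pres_reprP. Qed.

Lemma pres_mulA : associative pres_mul.
Proof.
move=> x y z; have [u ->] := pres_classP x; have [v ->] := pres_classP y.
by have [w ->] := pres_classP z; rewrite !pres_mulE catA.
Qed.

Lemma pres_mul1 : left_id pres_one pres_mul.
Proof. by move=> x; have [u ->] := pres_classP x; rewrite pres_mulE. Qed.

Lemma pres_mulr1 : right_id pres_one pres_mul.
Proof. by move=> x; have [u ->] := pres_classP x; rewrite pres_mulE cats0. Qed.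

Lemma pres_mulV : left_inverse pres_one pres_invg pres_mul.
Proof.
move=> x; have [u ->] := pres_classP x; rewrite pres_invE pres_mulE.
exact/pres_classE/pres_mulVw.
Qed.

Lemma pres_mulrV : right_inverse pres_one pres_invg pres_mul.
Proof.
move=> x; have [u ->] := pres_classP x; rewrite pres_invE pres_mulE.
exact/pres_classE/pres_mulwV.
Qed.

HB.instance Definition _ := isGroup.Build pres
  pres_mulA pres_mul1 pres_mulr1 pres_mulV pres_mulrV.

Definition pres_gens : n.-tuple pres :=
  [tuple pres_class [:: (i, false)] | i < n].

Lemma pres_word_val (w : word) : word_val pres_gens w = pres_class w.
Proof.
elim: w => [//|[i b] w IHw]; rewrite [LHS]/= IHw -cat1s -[RHS]pres_mulE.
congr pres_mul; rewrite /letter_val tnth_mktuple; case: b => //=.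
exact: pres_invE.
Qed.

Lemma pres_gensP : generates pres_gens.
Proof.
by move=> x; have [w ->] := pres_classP x; exists w; apply: pres_word_val.
Qed.

Definition marked_pres : marked_group n := MarkedGroup pres_gensP.

End Presentation.

(* [theta_W i] is theta_n(W_i), as a set of words; nu(pr n i) is the marked
   group [nu_coRP n i], defined when [nu_coRP_dom n i] holds. Marked groups being
   taken up to isomorphism, the names of M are those of any isomorphic copy. *)
Section Numbering.
Variables (phi : nat -> nat -> nat -> Prop) (pr : nat -> nat -> nat).
Variable theta : forall n, nat -> word n.

Definition theta_W (n i : nat) (w : word n) : Prop :=
  exists2 x, W phi i x & theta n x = w.

Definition nu_coRP_dom (n i : nat) : Prop :=
  0 < n /\ exists M : marked_group n, forall w, theta_W i w <-> coWP M w.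

Definition nu_coRP (n i : nat) : marked_group n :=
  marked_pres (fun w : word n => ~ theta_W i w).

Definition coRP_name (m : nat) (k : nat) (M : marked_group k) : Prop :=
  exists i, [/\ m = pr k i, nu_coRP_dom k i & marked_iso (nu_coRP k i) M].

Definition coRP_group (G : groupType) : Prop :=
  exists k (s : k.-tuple G) (gs : generates s) m, coRP_name m (MarkedGroup gs).

Definition coRP_decidable (P : groupType -> Prop) : Prop :=
  exists c : code, forall m k (M : marked_group k), coRP_name m M ->
    (P M /\ evals c m 1) \/ (~ P M /\ evals c m 0).

End Numbering.

Definition iso_invariant (P : groupType -> Prop) : Prop :=
  forall G H : groupType, isomorphic G H -> P G -> P H.

(* Main.v *)
(* Let G be a co-recursively presented group. From a program e and an input x
   one computes a name which enumerates the co-word problem of G once e halts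
   on x and enumerates nothing before: it is a name of G if e halts on x, and of
   the trivial group otherwise. Were P to separate G from the trivial group,
   deciding P would decide the halting problem. Hence P takes on every
   co-recursively presented group the value it takes on the trivial group. *)
Require Import Defs.
From HB Require Import structures.
From Stdlib Require Cantor.
From mathcomp Require Import all_boot.
From mathcomp Require Import boolp.

(** * Determinism of programs and injectivity of their numbering *)

Lemma cpairK x y : Cantor.of_nat (cpair x y) = (x, y).
Proof. exact: Cantor.cancel_of_to. Qed.

Lemma cpair_inj x y x' y' : cpair x y = cpair x' y' -> x = x' /\ y = y'.
Proof. by move=> /(congr1 Cantor.of_nat); rewrite !cpairK => -[]. Qed.

Lemma evals_fun c x y z : evals c x y -> evals c x z -> y = z.
Proof.
elim: c x y z => [||||c IHc d IHd|c IHc d IHd|c IHc d IHd|c IHc] x y z.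
- by move=> -> ->.
- by move=> -> ->.
- by move=> -> ->.
- by move=> -> ->.
- move=> [a [b [ca db ->]]] [a' [b' [ca' db' ->]]].
  by rewrite (IHc _ _ _ ca ca') (IHd _ _ _ db db').
- move=> [a da cy] [a' da' cz].
  by rewrite (IHd _ _ _ da' da) in cz; exact: IHc cy cz.
- rewrite /=; elim: (Cantor.of_nat x).2 y z => [|n IHn] y z; first exact: IHc.
  by move=> [v /IHn pv dy] [w /pv <- dz]; exact: IHd dy dz.
(* If the two outputs differ, then at the smaller one [c] takes both the value 0 and a successor
   value. *)
- move=> [cy lty] [cz ltz]; case: (ltngtP y z) => // [/ltz|/lty] [v cv].
  + by have := IHc _ _ _ cy cv.
  + by have := IHc _ _ _ cz cv.
Qed.

(** Numbers below 4 belong to the atomic programs; from 4 on, the residue modulo 4 reveals the head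
    constructor and the quotient encodes the subprograms. *)
Lemma godel_inj : injective godel.
Proof.
have pairE i j u v : i < 4 -> j < 4 -> 4 + i + 4 * u = 4 + j + 4 * v ->
    i = j /\ u = v.
  move=> lti ltj /eqP; rewrite -!addnA eqn_add2l => /eqP euv.
  have eij : i = j.
    have := congr1 (modn^~ 4) euv.
    by rewrite ![_ + 4 * _]addnC ![4 * _]mulnC !modnMDl !modn_small.
  split=> //; move/eqP: euv; rewrite eij eqn_add2l eqn_mul2l /=.
  by move/eqP.
have shape c : godel c < 4 \/ exists i u, i < 4 /\ godel c = 4 + i + 4 * u.
  case: c => [||||c d|c d|c d|c]; try by left.
  - by right; exists 0, (cpair (godel c) (godel d)).
  - by right; exists 1, (cpair (godel c) (godel d)).
  - by right; exists 2, (cpair (godel c) (godel d)).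
  - by right; exists 3, (godel c).
elim=> [||||c IHc d IHd|c IHc d IHd|c IHc d IHd|c IHc]
  [||||c' d'|c' d'|c' d'|c'] //.
- by case/(pairE 0 0) => // _ /cpair_inj[/IHc -> /IHd ->].
- by case/(pairE 0 1).
- by case/(pairE 0 2).
- by case/(pairE 0 3).
- by case/(pairE 1 0).
- by case/(pairE 1 1) => // _ /cpair_inj[/IHc -> /IHd ->].
- by case/(pairE 1 2).
- by case/(pairE 1 3).
- by case/(pairE 2 0).
- by case/(pairE 2 1).
- by case/(pairE 2 2) => // _ /cpair_inj[/IHc -> /IHd ->].
- by case/(pairE 2 3).
- by case/(pairE 3 0).
- by case/(pairE 3 1).
- by case/(pairE 3 2).
- by case/(pairE 3 3) => // _ /IHc ->.
Qed.

Lemma godel_enumE c x y : godel_enum (godel c) x y <-> evals c x y.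
Proof. by split=> [[d /godel_inj ->] // | cxy]; exists c. Qed.

(** * Closure properties of computable functions *)

Fixpoint const_code (a : nat) : code :=
  if a is b.+1 then CComp CSucc (const_code b) else CZero.

Lemma const_codeP a x : evals (const_code a) x a.
Proof. by elim: a => [//|a IHa]; exists a. Qed.

Lemma computable_const a : computable (fun=> a).
Proof. by exists (const_code a) => x; apply: const_codeP. Qed.

Lemma computable_succ : computable succn.
Proof. by exists CSucc. Qed.

Lemma computable_comp f g :
  computable f -> computable g -> computable (fun x => f (g x)).
Proof. by move=> [c cP] [d dP]; exists (CComp c d) => x; exists (g x). Qed.

Lemma computable_cpair f g :
  computable f -> computable g -> computable (fun x => cpair (f x) (g x)).
Proof.
by move=> [c cP] [d dP]; exists (CPair c d) => x; exists (f x), (g x).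
Qed.

Lemma computable_id : computable id.
Proof.
exists (CPair CFst CSnd) => x; exists (Cantor.of_nat x).1, (Cantor.of_nat x).2.
by split=> //; rewrite /cpair -surjective_pairing Cantor.cancel_to_of.
Qed.

Lemma computable2_comp f g h : computable2 f -> computable g -> computable h ->
  computable (fun x => f (g x) (h x)).
Proof.
move=> [c cP] /computable_cpair gP /gP[d dP].
by exists (CComp c d) => x; exists (cpair (g x) (h x)).
Qed.

Lemma computable_rec a h : computable2 h ->
  computable (nat_rec (fun=> nat) a h).
Proof.
move=> [c cP].
have [d dP] := computable_cpair _ _ (computable_const 0) computable_id.
(* [CPrec] expects a parameter besides the counter: [d] supplies a dummy 0, and [CSnd] discards it
   before each call of [c]. *)
exists (CComp (CPrec (const_code a) (CComp c CSnd)) d) => x.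
exists (cpair 0 x) => //=; rewrite cpairK /=; elim: x => [|x IHx].
  exact: const_codeP.
exists (nat_rec (fun=> nat) a h x) => //.
by exists (cpair x (nat_rec (fun=> nat) a h x)); rewrite ?cpairK.
Qed.

Lemma computable_iter a f : computable f -> computable (fun n => iter n f a).
Proof.
move=> [c cP]; have h2 : computable2 (fun _ v => f v).
  by exists (CComp c CSnd) => x y; exists y => //=; rewrite cpairK.
have [d dP] := computable_rec a _ h2; exists d => x.
suff -> : iter x f a = nat_rec (fun=> nat) a (fun=> f) x by [].
by elim: x => //= x ->.
Qed.

(** This is the shape of the Gödel numbers of compound programs. It is obtained by iterating the
    fourfold successor from [a]. *)
Lemma computable_add4M a f : computable f -> computable (fun x => a + 4 * f x).
Proof.
move=> fP; suff aP : computable (fun n => a + 4 * n).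
  exact: computable_comp aP fP.
have [c cP] : computable (fun n => iter n (fun m => m.+4) a).
  have S2 := computable_comp _ _ computable_succ computable_succ.
  exact/computable_iter/(computable_comp _ _ S2 S2).
exists c => x; suff -> : a + 4 * x = iter x (fun m => m.+4) a by [].
elim: x => [|x IHx]; first by rewrite muln0 addn0.
by rewrite iterS -IHx mulnS addnCA.
Qed.

Lemma computable_godel_const : computable (fun a => godel (const_code a)).
Proof.
(* The iterated map sends the number of a program to that of its composite with [CSucc], whose
   number is 1; the initial 0 is the number of [CZero]. *)
have [c cP] : computable (fun a => iter a (fun m => 5 + 4 * cpair 1 m) 0).
  apply/computable_iter/computable_add4M/computable_cpair => //.
    exact: computable_const.
  exact: computable_id.
exists c => a.
suff -> : godel (const_code a) = iter a (fun m => 5 + 4 * cpair 1 m) 0 by [].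
by elim: a => // a IHa; rewrite iterS -IHa.
Qed.

(** * Undecidability of halting *)

(** The program minimises a function that ignores the search variable and, on the two truth values,
    vanishes only at [b]: the search stops at once or never. *)
Lemma semidecide_eq_bool (b : bool) :
  exists t, forall b' : bool, (exists y, evals t b' y) <-> b' = b.
Proof.
have [c cP] : computable (fun x => if b then (x == 0 : nat) else x).
  case: b; last exact: computable_id.
  have zeroC : computable2 (fun _ _ => 0) by exists CZero.
  have [c cP] := computable_rec 1 _ zeroC.
  by exists c => -[|x]; apply: cP.
exists (CMu (CComp c CFst)) => b'; split=> [[y [[a]]] | ->].
- rewrite /= cpairK /= => -> cb0 _; have := evals_fun _ _ _ _ cb0 (cP b').
  by case: b b' {cP} cb0 => -[].
- exists 0; split=> //; exists b; first by rewrite /= cpairK.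
  by have := cP b; case: b {cP}.
Qed.

(** The pair forces [e] to be run on the fixed input [x], and only the output of [c] is kept. The
    domain is thus that of [c] or empty, according to whether [e] halts on [x]. *)
Definition after (c e : code) (x : nat) : code :=
  CComp CFst (CPair c (CComp e (const_code x))).

Lemma afterP c e x u y :
  evals (after c e x) u y <-> evals c u y /\ exists z, evals e x z.
Proof.
split.
- move=> [_ [a [b [cua [w wP ewb] ->]]]]; rewrite /= cpairK /= => ->.
  by split=> //; exists b; rewrite (evals_fun _ _ _ _ (const_codeP x u) wP).
- move=> [cuy [z ez]]; exists (cpair y z); last by rewrite /= cpairK.
  by exists y, z; split=> //; exists x => //; apply: const_codeP.
Qed.

Lemma computable_godel_after c : exists h, computable h /\
  forall e, h (godel e) = godel (after c e (godel e)).
Proof.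
(* The Gödel number of [after] written out, with 2 for [CFst] and [x] serving both as the number of
   [e] and as its input. *)
exists (fun x => 5 + 4 * cpair 2 (4 + 4 * cpair (godel c)
  (5 + 4 * cpair x (godel (const_code x))))); split=> //.
apply/computable_add4M/computable_cpair; first exact: computable_const.
apply/computable_add4M/computable_cpair; first exact: computable_const.
apply/computable_add4M/computable_cpair; first exact: computable_id.
exact: computable_godel_const.
Qed.

(* Diagonalization: e runs the decider d on the index of [after c e (godel e)]
   and halts exactly when the answer is the one expected if e diverges. *)
Lemma no_halting_separation (c d : code) (f : nat -> nat) (b : bool) :
  computable f ->
  ~ (forall e, let halts := exists y, evals e (godel e) y in
      (halts -> evals d (f (godel (after c e (godel e)))) (~~ b)) /\
      (~ halts -> evals d (f (godel (after c e (godel e)))) b)).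
Proof.
move=> fP sep; have [h [hP hE]] := computable_godel_after c.
have [q qP] := computable_comp _ _ fP hP.
have [t tP] := semidecide_eq_bool b.
pose e := CComp t (CComp d q).
have eP : (exists y, evals e (godel e) y) <->
    exists2 a, evals d (f (godel (after c e (godel e)))) a &
      exists y, evals t a y.
  rewrite -hE; split.
  - move=> [y [a [v qv dva] tay]]; exists a; last by exists y.
    by rewrite (evals_fun _ _ _ _ (qP (godel e)) qv).
  - by move=> [a da [y ty]]; exists y, a => //; exists (f (h (godel e))).
have [sep1 sep2] := sep e; have [he|nhe] := EM (exists y, evals e (godel e) y).
- have [a da ta] := eP.1 he.
  move: ta; rewrite (evals_fun _ _ _ _ da (sep1 he)) => /tP.
  by case: (b).
- by case: (nhe); apply/eP; exists b; [exact: sep2 | exact/tP].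
Qed.

(** * The trivial group, and names of groups *)

(** Taking all words as relators gives exactly the presentation read off an empty enumeration of the
    co-word problem. *)
Definition trivial_mg (k : nat) : marked_group k :=
  marked_pres (fun _ : word k => True).

Lemma trivial_mg1 k (x : trivial_mg k) : x = 1%g.
Proof. by have [u ->] := pres_classP x; apply/pres_classE/pres_rel. Qed.

Lemma trivial_mg_iso k l : isomorphic (trivial_mg k) (trivial_mg l).
Proof.
pose f (x : trivial_mg k) : trivial_mg l := 1%g.
have fM : {morph f : x y / (x * y)%g} by move=> x y; rewrite /f mulg1.
pose fm := isMultiplicative.Build _ _ f fM.
pose F : {multiplicative trivial_mg k -> trivial_mg l} := HB.pack f fm.
by exists F, (fun=> 1%g) => x; apply: etrans (esym _); apply: trivial_mg1.
Qed.

Lemma marked_iso_refl k (M : marked_group k) : marked_iso M M.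
Proof. by exists idfun; split=> //; exists id. Qed.

Section Names.

Variables (phi : nat -> nat -> nat -> Prop) (pr : nat -> nat -> nat).
Variable theta : forall n, nat -> word n.

Lemma empty_coRP_name k i : 0 < k -> (forall x, ~ W phi i x) ->
  coRP_name phi pr theta (pr k i) (trivial_mg k).
Proof.
move=> k0 Wi0; have tW0 w : ~ theta_W phi theta i w by case=> x /Wi0.
exists i; split=> //.
  split=> //; exists (trivial_mg k) => w.
  by split=> [/tW0|[]] //; apply: trivial_mg1.
have relE : (fun w : word k => ~ theta_W phi theta i w) = (fun=> True).
  by apply/funext => w; apply/propext; split=> // _; apply: tW0.
by rewrite /nu_coRP relE; apply: marked_iso_refl.
Qed.

Lemma eq_coRP_name k i j (M : marked_group k) : W phi i = W phi j ->
  nu_coRP_dom phi theta k i -> marked_iso (nu_coRP phi theta k i) M ->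
  coRP_name phi pr theta (pr k j) M.
Proof.
move=> Wij; have -> : nu_coRP_dom phi theta k i = nu_coRP_dom phi theta k j.
  by rewrite /nu_coRP_dom /theta_W Wij.
by rewrite /nu_coRP /theta_W Wij => ? ?; exists j.
Qed.

Lemma coRP_decidable_trivial k (M : marked_group k) m (P : groupType -> Prop) :
  standard_enum phi -> computable_pairing pr -> coRP_decidable phi pr theta P ->
  iso_invariant P -> coRP_name phi pr theta m M -> P M <-> P (trivial_mg k).
Proof.
move=> [f [g [_ gC phif gphi]]] [prC _] [d dP] Piso [i [_ domi isoi]].
have k0 : 0 < k by case: domi.
have Pdec m' k' (N : marked_group k') : coRP_name phi pr theta m' N ->
    evals d m' `[< P N >].
  by move=> /dP[[/asboolT -> //]|[/asboolF -> //]].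
(* If [f i] numbers no program, the enumeration of index [i] is empty, so [m] names both [M] and the
   trivial group, and determinism of [d] gives the same answer for both. *)
have [[c ci]|noc] := EM (exists c, godel c = f i); last first.
  have nameM : coRP_name phi pr theta (pr k i) M by exists i.
  have nameT : coRP_name phi pr theta (pr k i) (trivial_mg k).
    by apply: empty_coRP_name => // x [y /phif[c ci _]]; apply: noc; exists c.
  have := evals_fun _ _ _ _ (Pdec _ _ _ nameM) (Pdec _ _ _ nameT).
  by case: asboolP => PM; case: asboolP => PT.
(* Here [f] leads from [phi] to the program [c], and [g] leads back from the modified program to an
   index for [phi]. *)
have WE e x : W phi (g (godel (after c e x))) =
    (fun u => W phi i u /\ exists y, evals e x y).
  apply/funext => u; apply/propext; split.
  - move=> [y /gphi/godel_enumE/afterP[cuy ex]]; split=> //.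
    by exists y; apply/phif; rewrite -ci; apply/godel_enumE.
  - move=> [[y /phif]]; rewrite -ci => /godel_enumE cuy ex.
    by exists y; apply/gphi/godel_enumE/afterP.
have nameM e x : (exists y, evals e x y) ->
    coRP_name phi pr theta (pr k (g (godel (after c e x)))) M.
  move=> ex; apply: eq_coRP_name domi isoi; rewrite WE.
  by apply/funext => u; apply/propext; split=> [|[]].
have nameT e x : ~ (exists y, evals e x y) ->
    coRP_name phi pr theta (pr k (g (godel (after c e x)))) (trivial_mg k).
  by move=> nex; apply: empty_coRP_name => // u; rewrite WE => -[].
have fC : computable (fun x => pr k (g x)).
  exact: computable2_comp prC (computable_const k) gC.
(* If [P] told [M] from the trivial group, its value on the trivial group would be the answer for
   divergence, and its value on [M] the opposite answer for halting. *)
apply: contrapT => PMT.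
apply: (no_halting_separation c d _ `[< P (trivial_mg k) >] fC) => e halts.
split=> [ex|nex]; last by apply: Pdec; apply: nameT.
suff -> : ~~ `[< P (trivial_mg k) >] = `[< P M >] by apply: Pdec; apply: nameM.
apply/idP/idP => [/asboolPn nT|/asboolP PM].
  by apply/asboolP; apply: contrapT => nM; apply: PMT; split.
by apply/asboolPn => PT; apply: PMT; split.
Qed.

End Names.

Theorem corollary37 (phi : nat -> nat -> nat -> Prop) (pr : nat -> nat -> nat)
    (theta : forall n : nat, nat -> word n)
    (hphi : standard_enum phi) (hpr : computable_pairing pr)
    (htheta : computable_words theta)
    (P : groupType -> Prop) (hiso : iso_invariant P)
    (hdec : coRP_decidable phi pr theta P) :
  (forall G : groupType, coRP_group phi pr theta G -> P G) \/
  (forall G : groupType, coRP_group phi pr theta G -> ~ P G).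
Proof.
(* Markings of different lengths [k] lead to different copies of the trivial group; invariance of
   [P] brings them all to the one with a single generator. *)
have PE G : coRP_group phi pr theta G -> P G <-> P (trivial_mg 1).
  move=> [k [s [gs [m name]]]].
  rewrite (coRP_decidable_trivial _ _ _ _ _ _ _ hphi hpr hdec hiso name).
  by split; apply: hiso; apply: trivial_mg_iso.
have [P1|nP1] := EM (P (trivial_mg 1)); [left|right] => G /PE; tauto.
Qed.
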